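(* Let $X$ and $Y$ be fake weighted projective spaces related by a mutation. Suppose that $P=\mathrm{conv}\{v_0,\ldots,v_n\}\subset N_{\mathbb{Q}}$ is the simplex corresponding to $X$, that $Q\subset N_{\mathbb{Q}}$ is the simplex corresponding to $Y$, and that the weights of $X$ are $\lambda_0,\lambda_1,\ldots,\lambda_n$ (with $\lambda_i$ the weight corresponding to the vertex $v_i$). Let $w\in M$ be the primitive height function and $F\subset N_{\mathbb{Q}}$ be the factor such that $Q=\mathrm{mut}_w(P,F)$. Then we may relabel the vertices of $P$ (and correspondingly the weights $\lambda_i$) such that $w_{h_{\max}}(P)=v_0$, $w_{h_{\min}}(P)=\mathrm{conv}\{v_1,\ldots,v_k\}$, and the weights of $Y$ are \[ \frac{1}{d}\Big(\lambda_0\lambda_1,\ (\lambda_1+\cdots+\lambda_k)^2,\ \lambda_0\lambda_2,\ldots,\lambda_0\lambda_k,\ \lambda_{k+1}(\lambda_1+\cdots+\lambda_k),\ldots,\lambda_n(\lambda_1+\cdots+\lambda_k)\Big), \] where $d$ is a positive integer satisfying \[ d\cdot\frac{\mathrm{mult}(X)}{\mathrm{mult}(Y)}=\frac{\lambda_0^{k-1}}{(\lambda_1+\cdots+\lambda_k)^{k-2}}. \]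
   Context: $N\cong\mathbb{Z}^n$ is a lattice, $M=\mathrm{Hom}(N,\mathbb{Z})$, $N_{\mathbb{Q}}=N\otimes_{\mathbb{Z}}\mathbb{Q}$. A convex lattice polytope $P\subset N_{\mathbb{Q}}$ is Fano if $\dim P=n$, the origin lies in the strict interior of $P$, and the vertices of $P$ are primitive lattice points. Fano polytopes are considered up to $\mathrm{GL}_n(\mathbb{Z})$-equivalence. A Fano $n$-simplex is a Fano polytope that is a simplex, i.e. has $n+1$ vertices. Let $P=\mathrm{conv}\{v_0,\ldots,v_n\}$ be a Fano $n$-simplex. Its (reduced) weights are the unique coprime positive integers $\lambda_0,\ldots,\lambda_n$ with $\lambda_0v_0+\cdots+\lambda_nv_n=\mathbf{0}$. Its multiplicity is $\mathrm{mult}(P)=[N:N']$ where $N'=\mathbb{Z}v_0+\cdots+\mathbb{Z}v_n$. The toric variety $X_P$ of the fan spanned by the faces of $P$ is called a fake weighted projective space, and $P$ is the simplex corresponding to it; the weights of $X_P$ and $\mathrm{mult}(X_P)$ are those of $P$. Mutation: let $w\in M$ be primitive, extended to $N_{\mathbb{Q}}\to\mathbb{Q}$; $w(v)$ is the height of $v$. Put $H_{w,h}=\{v\in N_{\mathbb{Q}}: w(v)=h\}$, $w_h(P)=\mathrm{conv}(H_{w,h}\cap P\cap N)$ (possibly empty), $h_{\min}=\min\{w(v):v\in P\}$, $h_{\max}=\max\{w(v):v\in P\}$. A factor of $P$ with respect to $w$ is a lattice polytope $F\subset N_{\mathbb{Q}}$ with $w(F)=0$ such that for every integer $h$ with $h_{\min}\le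 h<0$ there is a (possibly empty) lattice polytope $G_h\subset N_{\mathbb{Q}}$ with $H_{w,h}\cap\mathrm{vert}(P)\subseteq G_h+(-h)F\subseteq w_h(P)$, where $\mathrm{vert}(P)$ is the set of vertices of $P$. The mutation of $P$ with respect to $w$ and $F$ is \[\mathrm{mut}_w(P,F)=\mathrm{conv}\Big(\bigcup_{h=h_{\min}}^{-1}G_h\cup\bigcup_{h=0}^{h_{\max}}\big(w_h(P)+hF\big)\Big),\] which is known to be independent of the choice of the $G_h$, and to be Fano if and only if $P$ is Fano. Fake weighted projective spaces $X$ and $Y$ are related by a mutation if their simplices $P$ and $Q$ satisfy $Q=\mathrm{mut}_w(P,F)$ for some such $w$ and $F$.
   Formalization: The factor F is assumed not to be a single point (trivial mutations, where Q is a shear of P, are excluded); for one-point F the claim fails, e.g. P=conv{(1,0),(0,1),(-1,-1)}, w=(1,1), F={0}, where w_{h_max}(P) is an edge. *)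

(* Defs.v *)
(* MathComp / MathComp-Analysis; the lattice is N = Z^n, its elements are
   integer row vectors and N_Q = Q^n.  Elements of the dual lattice M are integer
   column vectors, acting by v |-> v *m w. *)
From HB Require Import structures.
From mathcomp Require Export all_boot all_order all_algebra perm.
From mathcomp Require Import finmap.
From mathcomp Require Export boolp classical_sets cardinality.
From mathcomp Require Import topology normedtype.
Export numFieldNormedType.Exports.

Set Implicit Arguments.
Unset Strict Implicit.
Unset Printing Implicit Defensive.

Import Order.TTheory GRing.Theory Num.Theory.
Local Open Scope ring_scope.
Local Open Scope classical_set_scope.

Definition toQ (n : nat) (x : 'rV[int]_n) : 'rV[rat]_n := map_mx intr x.

Definition height (n : nat) (w : 'cV[int]_n) (x : 'rV[rat]_n) : rat :=
  (x *m map_mx intr w) 0 0.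

(* The zero vector is not primitive, as 0 = 2 *: 0. *)
Definition primitive (p q : nat) (x : 'M[int]_(p, q)) : Prop :=
  forall (c : int) (y : 'M[int]_(p, q)), x = c *: y -> `|c|%N = 1%N.

Definition conv (n : nat) (A : set 'rV[rat]_n) : set 'rV[rat]_n :=
  [set x | exists (m : nat) (a : 'I_m -> rat) (p : 'I_m -> 'rV[rat]_n),
    [/\ forall i, 0 <= a i, \sum_i a i = 1, forall i, A (p i)
      & x = \sum_i a i *: p i]].

Definition minkowski (n : nat) (A B : set 'rV[rat]_n) : set 'rV[rat]_n :=
  [set x + y | x in A & y in B].

Definition dilate (n : nat) (c : rat) (A : set 'rV[rat]_n) : set 'rV[rat]_n :=
  [set c *: x | x in A].

(* The empty polytope is allowed (s = [::]). *)
Definition lattice_polytope (n : nat) (P : set 'rV[rat]_n) : Prop :=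
  exists s : seq 'rV[int]_n, P = conv [set toQ x | x in [set` s]].

Definition vert (n : nat) (P : set 'rV[rat]_n) : set 'rV[rat]_n :=
  [set x | P x /\ forall (y z : 'rV[rat]_n) (t : rat),
    P y -> P z -> 0 < t < 1 -> x = t *: y + (1 - t) *: z -> y = x /\ z = x].

(* dim P = n: P contains n + 1 affinely independent points. *)
Definition full_dim (n : nat) (P : set 'rV[rat]_n) : Prop :=
  exists (x : 'rV[rat]_n) (B : 'M[rat]_n),
    [/\ P x, forall i, P (x + row i B) & B \in unitmx].

(* The interior is taken in Q^n with its usual (sup norm) topology. *)
Definition fano (n : nat) (P : set 'rV[rat]_n) : Prop :=
  [/\ lattice_polytope P, full_dim P, interior (P : set 'rV[rat^o]_n) 0
    & forall x, vert P x -> exists2 y : 'rV[int]_n, primitive y & x = toQ y].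

Definition simplex (n : nat) (v : 'I_n.+1 -> 'rV[int]_n) : set 'rV[rat]_n :=
  conv [set toQ (v i) | i in setT].

(* v_0, ..., v_n are the n + 1 distinct vertices of a Fano n-simplex. *)
Definition fano_simplex (n : nat) (v : 'I_n.+1 -> 'rV[int]_n) : Prop :=
  [/\ fano (simplex v), injective v
    & vert (simplex v) = [set toQ (v i) | i in setT]].

Definition weights (n : nat) (v : 'I_n.+1 -> 'rV[int]_n)
    (l : 'I_n.+1 -> nat) : Prop :=
  [/\ forall i, (0 < l i)%N, (\big[gcdn/0]_i l i)%N = 1%N
    & \sum_i v i *+ l i = 0].

Definition sublattice (n : nat) (v : 'I_n.+1 -> 'rV[int]_n) : set 'rV[int]_n :=
  [set \sum_i v i *~ a i | a in [set: 'I_n.+1 -> int]].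

Definition cosets (n : nat) (L : set 'rV[int]_n) : set (set 'rV[int]_n) :=
  [set [set x + y | y in L] | x in [set: 'rV[int]_n]].

(* The index [N : N']; the value is 0 if there are infinitely many cosets. *)
Definition mult (n : nat) (v : 'I_n.+1 -> 'rV[int]_n) : nat :=
  #|` fset_set (cosets (sublattice v)) |%fset.

Definition is_min (A : set rat) (h : rat) : Prop :=
  A h /\ forall y, A y -> h <= y.

Definition is_max (A : set rat) (h : rat) : Prop :=
  A h /\ forall y, A y -> y <= h.

(* The extremal heights; they exist for every nonempty polytope, and the
   default value 0 is then irrelevant. *)
Definition hmin (n : nat) (w : 'cV[int]_n) (P : set 'rV[rat]_n) : rat :=
  xget 0 (is_min [set height w x | x in P]).

Definition hmax (n : nat) (w : 'cV[int]_n) (P : set 'rV[rat]_n) : rat :=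
  xget 0 (is_max [set height w x | x in P]).

Definition hyperplane (n : nat) (w : 'cV[int]_n) (h : rat) : set 'rV[rat]_n :=
  [set x | height w x = h].

(* w_h(P) *)
Definition slice (n : nat) (w : 'cV[int]_n) (h : rat) (P : set 'rV[rat]_n) :
    set 'rV[rat]_n :=
  conv (hyperplane w h `&` P `&` range (@toQ n)).

(* The condition on G_h. *)
Definition remainder (n : nat) (w : 'cV[int]_n) (P F : set 'rV[rat]_n)
    (h : int) (G : set 'rV[rat]_n) : Prop :=
  [/\ lattice_polytope G,
      hyperplane w h%:~R `&` vert P `<=` minkowski G (dilate (- h%:~R) F)
    & minkowski G (dilate (- h%:~R) F) `<=` slice w h%:~R P].

Definition is_factor (n : nat) (w : 'cV[int]_n) (P F : set 'rV[rat]_n) : Prop :=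
  [/\ lattice_polytope F, forall x, F x -> height w x = 0
    & forall h : int, hmin w P <= h%:~R -> h < 0 ->
        exists G, remainder w P F h G].

(* A one-point factor F = {f} gives the trivial mutation, mut_w(P, F) being the
   image of P under the shear x |-> x + w(x) f; every w admits F = {0}. *)
Definition is_point (n : nat) (F : set 'rV[rat]_n) : Prop :=
  exists x, F = [set x].

Definition mut (n : nat) (w : 'cV[int]_n) (P F : set 'rV[rat]_n)
    (G : int -> set 'rV[rat]_n) : set 'rV[rat]_n :=
  conv (\bigcup_(h in [set h : int | hmin w P <= h%:~R /\ h < 0]) G h `|`
        \bigcup_(h in [set h : int | 0 <= h /\ h%:~R <= hmax w P])
          minkowski (slice w h%:~R P) (dilate h%:~R F)).

(* Q = mut_w(P, F); mut_w(P, F) does not depend on the choice of the G_h, so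
   this is stated with an arbitrary choice. *)
Definition is_mutation (n : nat) (w : 'cV[int]_n) (P F Q : set 'rV[rat]_n) :
    Prop :=
  [/\ primitive w, is_factor w P F
    & exists2 G : int -> set 'rV[rat]_n,
        forall h : int, hmin w P <= h%:~R -> h < 0 -> remainder w P F h (G h)
        & Q = mut w P F G].

(* The sum l_1 + ... + l_k. *)
Definition weight_sum (n : nat) (l : 'I_n.+1 -> nat) (k : nat) : nat :=
  (\sum_(i < n.+1 | 1 <= i <= k) l i)%N.

(* The tuple (l_0 l_1, S^2, l_0 l_2, ..., l_0 l_k, l_(k+1) S, ..., l_n S), with
   S = l_1 + ... + l_k; it is only used for 1 <= k <= n, so that
   [inord 1 : 'I_n.+1] is the index 1. *)
Definition mutated_weight (n : nat) (l : 'I_n.+1 -> nat) (k : nat)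
    (i : 'I_n.+1) : nat :=
  (let S := weight_sum l k in
   if i == 0 :> nat then l ord0 * l (inord 1)
   else if i == 1 :> nat then S ^ 2
   else if i <= k then l ord0 * l i
   else l i * S)%N.

(* Main.v *)
Require Import Defs.
From mathcomp Require Import finmap ring zify.

(* Let beta be the barycentric coordinates of P = conv{v_0, ..., v_n}, let -b < 0 < a
   be the extremal heights and I the set of vertices of height -b.  Since
   v_i = g_i + b f_i with g_i in G_{-b} and f_i in F for i in I, while g_i + b F lies in
   the bottom face, the f_i form a homothetic copy of that face: the linear part of beta
   takes at f_i the value m + c e_i, where m is its coordinatewise minimum over F and
   c > 0 because F is not a point.  The n + 1 functions psi = beta - w m are nonnegative
   on Q = mut_w(P, F), and psi_j <= 1 there for j outside I.

   Put x(j, i) = v_j + w(v_j) f_i; then psi(x(j, i)) = e_j + w(v_j) c e_i, which makes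
   x(j, i) the only maximum over Q of a signed sum of the psi_l, hence a vertex of Q.
   If v_t has maximal height, the points x(t, i) for i in I, one x(i_0, i_0) and the
   x(j, i_0) for the other j are n + 1 distinct vertices, so they are all of them.
   Comparing with x(i_1, i_1) and x(j, i_1) for another i_1 in I forces b c = 1 and
   w(v_j) = 0 for j outside I and different from t.  So the vertices of Q are a point g
   of height -b, the points v_t + (a/b)(v_i - g) for i in I, and the remaining v_j.

   The weights can then be read off.  Smith normal form gives
   mult(P) lambda_i = |det(v_j)_{j <> i}|, and the matrix of the vertices of Q other
   than g is the one of the vertices of P other than v_t, multiplied on the left by a
   diagonal matrix with k entries a/b and on the right by a reflection. *)

Set Implicit Arguments.
Unset Strict Implicit.
Unset Printing Implicit Defensive.

Import Order.TTheory GRing.Theory Num.Theory.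
Local Open Scope ring_scope.
Local Open Scope classical_set_scope.

(** * Multiplicity, weights and maximal minors *)

Definition vmx (n : nat) (v : 'I_n.+1 -> 'rV[int]_n) : 'M[int]_(n.+1, n) :=
  \matrix_i v i.

Lemma vmx_sum (n : nat) (v : 'I_n.+1 -> 'rV[int]_n) (c : 'rV[int]_n.+1) :
  c *m vmx v = \sum_i v i *~ c 0 i.
Proof.
rewrite mulmx_sum_row; apply: eq_bigr => i _.
by rewrite rowK -scaler_int intz.
Qed.

Lemma sublatticeE (n : nat) (v : 'I_n.+1 -> 'rV[int]_n) :
  sublattice v = range (fun c : 'rV[int]_n.+1 => c *m vmx v).
Proof.
apply/seteqP; split=> x [a _ <-].
  by exists (\row_i a i) => //; rewrite vmx_sum; apply: eq_bigr => i _; rewrite mxE.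
by exists (fun i => a 0 i) => //; rewrite vmx_sum.
Qed.

Lemma mult_perm (n : nat) (v : 'I_n.+1 -> 'rV[int]_n) (s : 'S_n.+1) :
  mult (fun i => v (s i)) = mult v.
Proof.
rewrite /mult; suff -> : sublattice (fun i => v (s i)) = sublattice v by [].
apply/seteqP; split=> x [a _ <-].
  exists (fun i => a ((s^-1)%g i)) => //.
  rewrite (reindex_inj (@perm_inj _ s)) /=.
  by apply: eq_bigr => i _; rewrite permK.
exists (fun i => a (s i)) => //.
by rewrite [RHS](reindex_inj (@perm_inj _ s)) /=.
Qed.

(** In the coordinates [y *m invmx R] the sublattice is a product of the ideals generated by the
    [d j], so a coset amounts to one residue modulo each [d j]. *)
Lemma mult_elementary_divisors (n : nat) (v : 'I_n.+1 -> 'rV[int]_n)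
    (R : 'M[int]_n) (d : 'I_n -> int) :
  R \in unitmx -> (forall j, d j != 0) ->
  (forall y, sublattice v y <-> forall j, (d j %| (y *m invmx R) 0%R j)%Z) ->
  mult v = (\prod_j `|d j|)%N.
Proof.
move=> Ru dn0 Lv.
pose T := {dffun forall j : 'I_n, 'I_(`|d j|%N)}.
pose x (r : T) : 'rV[int]_n := (\row_j (r j)%:Z) *m R.
pose C (y : 'rV[int]_n) := [set y + z | z in sublattice v].
have L0 : sublattice v 0 by apply/Lv => j; rewrite mul0mx mxE dvdz0.
have LB y z : sublattice v y -> sublattice v z -> sublattice v (y - z).
  by move=> /Lv Ly /Lv Lz; apply/Lv => j; rewrite mulmxBl mxE [X in _ + X]mxE rpredB.
have LD y z : sublattice v y -> sublattice v z -> sublattice v (y + z).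
  by move=> /Lv Ly /Lv Lz; apply/Lv => j; rewrite mulmxDl mxE rpredD.
have CE y z : C y = C z <-> sublattice v (y - z).
  split=> [E|Lyz].
    have : C y y by exists 0 => //; rewrite addr0.
    by rewrite E => -[t Lt <-]; rewrite addrC addKr.
  apply/seteqP; split=> _ [t Lt <-].
    by exists ((y - z) + t); [apply: LD|rewrite addrA addrCA subrr addr0].
  by exists (t - (y - z)); [apply: LB|rewrite opprB addrCA [y + _]addrC subrK addrC].
have Cx : cosets (sublattice v) = [set C (x r) | r in [set: T]].
  apply/seteqP; split=> [_ [y _ <-]|_ [r _ <-]]; last by exists (x r).
  pose c := y *m invmx R.
  have lt j : (`|(c 0%R j %% d j)%Z|%N < `|d j|)%N.
    by rewrite -ltz_nat gez0_abs ?modz_ge0// ltz_mod.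
  exists ([ffun j => Ordinal (lt j)] : T) => //.
  apply/CE/Lv => j; rewrite mulmxBl mulmxK// -/c mxE [X in _ + X]mxE.
  rewrite [X in X - _]mxE ffunE /=.
  by rewrite gez0_abs ?modz_ge0// -eqz_mod_dvd modz_mod.
have injx : injective (fun r : T => C (x r)).
  move=> r r' /CE/Lv E; apply/ffunP => j; apply/val_inj/eqP => /=.
  move: (E j); rewrite mulmxBl !mulmxK// !mxE -eqz_mod_dvd.
  rewrite -[X in X == _]modz_abs -[X in _ == X]modz_abs.
  by rewrite !modz_small ?lez_nat ?ltz_nat ?ltn_ord.
have -> : (\prod_j `|d j|)%N = #|T|.
  by rewrite card_dep_ffun foldrE big_image /=; apply: eq_bigr => j _; rewrite card_ord.
rewrite /mult Cx.
have -> : fset_set [set C (x r) | r in [set: T]] = [fset C (x r) | r : T]%fset.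
  apply/fsetP => A; rewrite in_fset_set; last first.
    exact/finite_image/finite_finset.
  apply/idP/imfsetP => [|[r _ ->]].
    by move=> /set_mem[r _ <-]; exists r.
  by apply: mem_set; exists r.
by rewrite card_imfset //= cardE.
Qed.

(** In the Smith form [L *m D *m R] of [vmx v], the weights are, up to sign, a common factor times
    the maximal minors of [L] without its last column. Coprimality makes that factor a unit, and the
    diagonal entries of [D] have product [mult v] up to sign. *)
Lemma det_row'_mult (n : nat) (v : 'I_n.+1 -> 'rV[int]_n) (l : 'I_n.+1 -> nat)
    (vfree : forall z : 'cV[int]_n, vmx v *m z = 0 -> z = 0) :
  weights v l ->
  (0 < mult v)%N /\ forall i, `|\det (row' i (vmx v))|%N = (mult v * l i)%N.
Proof.
move=> [lp lg l0].
have [L Lu [R Ru [d _ E]]] := int_Smith_normal_form (vmx v).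
pose D : 'M[int]_(n.+1, n) := \matrix_(i, j) (d`_i *+ (i == j :> nat)).
pose e := \row_(j < n) d`_j.
have LD m (A : 'M[int]_(m, n.+1)) : A *m D = col' ord_max A *m diag_mx e.
  apply/matrixP => i j; rewrite mul_mx_diag !mxE (bigD1 (lift ord_max j)) //=.
  rewrite !mxE lift_max eqxx big1 ?addr0// => k kj.
  rewrite !mxE; case: eqP => [kje|]; last by rewrite mulr0.
  by case/eqP: kj; apply: ord_inj; rewrite lift_max.
(* A zero elementary divisor would give a nonzero column killed by [vmx v], against [vfree]. *)
have d0 j : (j < n)%N -> d`_j != 0 :> int.
  move=> ltj; pose j' := Ordinal ltj; apply/eqP => dj0.
  pose z := invmx R *m (delta_mx j' 0 : 'cV[int]_n).
  have z0 : z = 0.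
    apply: vfree; rewrite E -!mulmxA mulKVmx// -colE.
    suff -> : col j' D = 0 by rewrite mulmx0.
    apply/colP => i; rewrite !mxE; case: eqP => // ->.
    by rewrite dj0.
  have := mulKVmx Ru (delta_mx j' 0 : 'cV[int]_n); rewrite -/z z0 mulmx0.
  by move/colP/(_ j'); rewrite !mxE !eqxx.
have mE : mult v = (\prod_(j < n) `|(d`_j : int)|)%N.
  apply: (mult_elementary_divisors (R := R)) => // [j|y]; first exact: d0.
  rewrite sublatticeE; split=> [[c _ <-] j|dvd].
    rewrite E !mulmxA mulmxK// -/D LD mul_mx_diag mxE [X in _ * X]mxE.
    exact: dvdz_mull.
  (* The last row of [D] is zero, so the last entry of a preimage is free; 0 is chosen. *)
  pose q (i : 'I_n.+1) :=
    if unlift ord_max i is Some j then ((y *m invmx R) 0%R j %/ d`_j)%Z else 0.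
  exists ((\row_i q i) *m invmx L) => //=.
  rewrite E !mulmxA mulmxKV// -/D LD -[RHS](mulmxKV Ru); congr (_ *m _).
  apply/rowP => j; rewrite mul_mx_diag mxE [X in _ * X]mxE [X in X * _]mxE.
  by rewrite [X in X * _]mxE /q liftK divzK.
split; first by rewrite mE prodn_gt0// => j; rewrite absz_gt0 d0.
(* The weight relation in Smith coordinates: [D] kills it, so only its last entry survives, and
   [\adj L] turns that entry back into weights, as multiples of minors. *)
pose q := (\row_i (l i)%:Z) *m L.
have qD : q *m D = 0.
  have : (\row_i (l i)%:Z) *m vmx v = 0.
    by rewrite vmx_sum -[RHS]l0; apply: eq_bigr => i _; rewrite mxE.
  by rewrite E !mulmxA -/q -/D => /(canRL (mulmxK Ru)); rewrite mul0mx.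
have q0 j : q 0 (lift ord_max j) = 0.
  move/rowP/(_ j): qD; rewrite LD mul_mx_diag !mxE => /eqP.
  by rewrite mulf_eq0 (negPf (d0 _ _))// orbF => /eqP.
have qL : q *m \adj L = \det L *: \row_i (l i)%:Z.
  by rewrite /q -mulmxA mul_mx_adj mul_mx_scalar.
have abs_unit k (A : 'M[int]_k) : A \in unitmx -> `|\det A|%N = 1%N.
  by rewrite unitmxE => /orP[/eqP->|/eqP->].
clearbody q; pose c := q 0 ord_max; pose m i := \det (row' i (col' ord_max L)).
have lE i : l i = (`|c| * `|m i|)%N.
  have := congr1 (fun r : 'rV_n.+1 => `|r 0%R i|%N) qL.
  rewrite /= !mxE (bigD1 ord_max) //= big1 ?addr0; last first.
    move=> k; case: (unliftP ord_max k) => [j ->|->]; last by rewrite eqxx.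
    by rewrite q0 mul0r.
  by rewrite mxE /cofactor !abszM absz_sign (abs_unit _ L)// !mul1n absz_nat => ->.
have c1 : (`|c| = 1)%N.
  apply/eqP; rewrite -dvdn1 -lg; apply/dvdn_biggcdP => i _.
  by rewrite lE dvdn_mulr.
move=> i; rewrite mE lE c1 mul1n E.
have -> : row' i (L *m D *m R) = row' i (col' ord_max L) *m diag_mx e *m R.
  rewrite [in LHS]row'Esub -!mul_rowsub_mx LD.
  by congr (_ *m _ *m _); apply/matrixP => a b; rewrite !mxE.
rewrite !det_mulmx det_diag !abszM.
rewrite (abs_unit _ R)// muln1 mulnC (big_morph absz abszM absz1); congr (_ * _)%N.
by apply: eq_bigr => j _; rewrite mxE.
Qed.

(** * Rational points, heights and convex hulls *)

Definition vmxQ (n : nat) (v : 'I_n.+1 -> 'rV[int]_n) : 'M[rat]_(n.+1, n) :=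
  map_mx intr (vmx v).

Lemma row_vmxQ (n : nat) (v : 'I_n.+1 -> 'rV[int]_n) i :
  row i (vmxQ v) = toQ (v i).
Proof. by rewrite -map_row rowK. Qed.

Lemma mul_vmxQ (n : nat) (v : 'I_n.+1 -> 'rV[int]_n) (c : 'rV[rat]_n.+1) :
  c *m vmxQ v = \sum_i c 0 i *: toQ (v i).
Proof. by rewrite mulmx_sum_row; apply: eq_bigr => i _; rewrite row_vmxQ. Qed.

Lemma height_toQ n (w : 'cV[int]_n) x : height w (toQ x) = ((x *m w) 0 0)%:~R.
Proof. by rewrite /height /toQ -map_mxM mxE. Qed.

Lemma heightD n (w : 'cV[int]_n) x y : height w (x + y) = height w x + height w y.
Proof. by rewrite /height mulmxDl mxE. Qed.

Lemma heightZ n (w : 'cV[int]_n) a x : height w (a *: x) = a * height w x.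
Proof. by rewrite /height -scalemxAl mxE. Qed.

Lemma sub_conv n (A : set 'rV[rat]_n) : A `<=` conv A.
Proof.
move=> x Ax; exists 1%N, (fun=> 1), (fun=> x); split=> //.
  by rewrite big_ord1.
by rewrite big_ord1 scale1r.
Qed.

Lemma conv_mono n (A B : set 'rV[rat]_n) : A `<=` B -> conv A `<=` conv B.
Proof.
by move=> AB x [m [a [p [a0 a1 Ap ->]]]]; exists m, a, p; split=> // i; apply: AB.
Qed.

Lemma conv_mulmx_le n p (A : set 'rV[rat]_n) (B : 'M[rat]_(n, p)) l c :
  (forall x, A x -> (x *m B) 0 l <= c) -> forall x, conv A x -> (x *m B) 0 l <= c.
Proof.
move=> Ac x [m [a [q [a0 a1 Aq ->]]]].
rewrite mulmx_suml summxE -[c]mul1r -a1 mulr_suml.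
by apply: ler_sum => i _; rewrite -scalemxAl mxE ler_wpM2l// Ac.
Qed.

Lemma conv_mulmx_ge n p (A : set 'rV[rat]_n) (B : 'M[rat]_(n, p)) l c :
  (forall x, A x -> c <= (x *m B) 0 l) -> forall x, conv A x -> c <= (x *m B) 0 l.
Proof.
move=> Ac x cx.
have := @conv_mulmx_le n p A (- B) l (- c) _ x cx.
by rewrite mulmxN mxE lerN2; apply=> y Ay; rewrite mulmxN mxE lerN2 Ac.
Qed.

(** The gaps between the maximum and the values at the points combined are nonnegative and average
    to 0, so any point with a nonzero coefficient attains the maximum and is [x]. *)
Lemma conv_strict_max n (A : set 'rV[rat]_n) (z : 'cV[rat]_n) x :
  conv A x -> (forall y, A y -> (y *m z) 0 0 <= (x *m z) 0 0) ->
  (forall y, A y -> (y *m z) 0 0 = (x *m z) 0 0 -> y = x) -> A x.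
Proof.
move=> [m [a [q [a0 a1 Aq xE]]]] le_x eq_x.
have : \sum_i a i * ((x *m z) 0 0 - (q i *m z) 0 0) = 0.
  under eq_bigr do rewrite mulrBr.
  rewrite sumrB -mulr_suml a1 mul1r {1}xE mulmx_suml summxE.
  by apply/eqP; rewrite subr_eq0; apply/eqP/eq_bigr => i _; rewrite -scalemxAl mxE.
move/psumr_eq0P => eq0.
have {}eq0 i : a i * ((x *m z) 0 0 - (q i *m z) 0 0) = 0.
  by apply: eq0 => // j _; rewrite mulr_ge0// subr_ge0 le_x.
have [i ai] : exists i, a i != 0.
  apply/existsP; apply: contraTT isT; rewrite negb_exists => /forallP a00.
  have := oner_neq0 rat; rewrite -a1 big1 ?eqxx// => i _.
  by apply/eqP; move: (a00 i); rewrite negbK.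
move/eqP: (eq0 i); rewrite mulf_eq0 (negPf ai) subr_eq0 => /eqP E.
by rewrite -(eq_x (q i)).
Qed.

Lemma conv_set1 n (x : 'rV[rat]_n) : conv [set x] = [set x].
Proof.
apply/seteqP; split=> [y [m [a [q [_ a1 Aq ->]]]]|]; last exact: sub_conv.
under eq_bigr do rewrite Aq.
by rewrite -scaler_suml a1 scale1r.
Qed.

(** * Barycentric coordinates *)

(* [x *m N + k] is the row of the barycentric coordinates of [x] with respect
   to [v]. *)
Definition barycentric (n : nat) (v : 'I_n.+1 -> 'rV[int]_n)
    (N : 'M[rat]_(n, n.+1)) (k : 'rV[rat]_n.+1) : Prop :=
  [/\ forall i, toQ (v i) *m N + k = delta_mx 0 i, N *m vmxQ v = 1%:M,
      k *m vmxQ v = 0, forall x : 'rV[rat]_n, \sum_l (x *m N) 0 l = 0 & \sum_l k 0 l = 1].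

(** Border the matrix of vertices with a column of ones: a relation between the columns is an affine
    function vanishing on the simplex, hence zero by full dimension. The blocks of the inverse are
    [k] and [N]. *)
Lemma barycentric_ex n (v : 'I_n.+1 -> 'rV[int]_n) :
  full_dim (simplex v) -> exists N k, barycentric v N k.
Proof.
move=> [x [B [Px PB Bu]]].
pose M : 'M[rat]_(n.+1) := row_mx (const_mx 1 : 'cV_n.+1) (vmxQ v).
have Mu : M \in unitmx.
  rewrite -unitmx_tr -row_free_unit -kermx_eq0; apply/rowV0P => z /sub_kermxP zM.
  pose z0 := lsubmx (z : 'rV[rat]_(1 + n)); pose z1 := rsubmx (z : 'rV[rat]_(1 + n)).
  have Mz i : z0 0 0 + (toQ (v i) *m z1^T) 0 0 = 0.
    move/(congr1 trmx): zM; rewrite trmx_mul trmxK trmx0 => /colP/(_ i).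
    rewrite -[z](@hsubmxK _ 1 1 n) -/z0 -/z1 (@tr_row_mx _ 1 1 n) /M (@mul_row_col _ n.+1 1 n 1).
    rewrite [X in _ = X]mxE mxE => <-; congr (_ + _).
      by rewrite [RHS]mxE big_ord1 [const_mx _ _ _]mxE mul1r [RHS]mxE.
    by rewrite -row_vmxQ -row_mul mxE.
  have Pz y : simplex v y -> (y *m z1^T) 0 0 = - z0 0 0.
    move=> Py; apply/eqP; rewrite eq_le; apply/andP; split.
      apply: conv_mulmx_le Py => _ [i _ <-].
      by rewrite -[leLHS](addKr (z0 0 0)) Mz addr0.
    apply: conv_mulmx_ge Py => _ [i _ <-].
    by rewrite -[leRHS](addKr (z0 0 0)) Mz addr0.
  have z10 : z1 = 0.
    apply: trmx_inj; rewrite trmx0; apply: (can_inj (mulKmx Bu)); rewrite mulmx0.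
    apply/colP => i; rewrite [RHS]mxE.
    have := Pz _ (PB i); rewrite mulmxDl mxE Pz// -[RHS]addr0 => /addrI.
    by rewrite -row_mul mxE.
  have z00 : z0 = 0.
    apply/rowP => j; rewrite ord1 [RHS]mxE; have := Pz _ Px.
    by rewrite z10 trmx0 mulmx0 mxE => /eqP; rewrite eq_sym oppr_eq0 => /eqP.
  by rewrite -[z](@hsubmxK _ 1 1 n) -/z0 -/z1 z00 z10 (@row_mx0 _ 1 1 n).
pose W := invmx M : 'M[rat]_(1 + n, n.+1).
have WE : W = col_mx (usubmx W) (dsubmx W) by rewrite vsubmxK.
exists (dsubmx W), (usubmx W).
have MW : const_mx 1 *m usubmx W + vmxQ v *m dsubmx W = 1%:M.
  by rewrite -(@mul_row_col _ n.+1 1 n n.+1) -WE mulmxV.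
have : col_mx (usubmx W) (dsubmx W) *m row_mx (const_mx 1) (vmxQ v) = 1%:M.
  by rewrite -WE; apply: (mulVmx Mu).
rewrite mul_col_row scalar_mx_block.
move=> /eq_block_mx[k1 kV N1 NV].
split=> // [i|x'|].
- rewrite -row_vmxQ -row_mul -row1 -MW; apply/rowP => j; rewrite !mxE addrC; congr (_ + _).
  by rewrite big_ord1 !mxE mul1r.
- have : (x' *m dsubmx W) *m const_mx 1 = 0 :> 'cV_1 by rewrite -mulmxA N1 mulmx0.
  move/colP/(_ 0); rewrite !mxE => E; rewrite -[RHS]E; apply: eq_bigr => l _.
  by rewrite [const_mx _ _ _]mxE mulr1.
- move/colP/(_ 0): k1; rewrite mxE => E; rewrite -[RHS](_ : (1%:M : 'M[rat]_1) 0 0 = 1) ?mxE//.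
  by rewrite mxE in E; rewrite -E; apply: eq_bigr => l _; rewrite [const_mx _ _ _]mxE mulr1.
Qed.

Lemma barycentric_sum n (v : 'I_n.+1 -> 'rV[int]_n) N k (x : 'rV[rat]_n) :
  barycentric v N k -> x = \sum_l (x *m N + k) 0 l *: toQ (v l).
Proof. by move=> [_ NV kV _ _]; rewrite -mul_vmxQ mulmxDl kV addr0 -mulmxA NV mulmx1. Qed.

Lemma barycentric_vertex n (v : 'I_n.+1 -> 'rV[int]_n) N k i l :
  barycentric v N k -> (toQ (v i) *m N) 0 l + k 0 l = (l == i)%:R.
Proof. by case=> /(_ i) /rowP/(_ l) + _ _ _ _; rewrite !mxE eqxx. Qed.

Lemma barycentric_conv n (v : 'I_n.+1 -> 'rV[int]_n) N k (x : 'rV[rat]_n) l :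
  barycentric v N k -> simplex v x -> 0 <= (x *m N) 0 l + k 0 l <= 1.
Proof.
move=> bN vx; apply/andP; split.
  rewrite -lerBlDr sub0r; apply: conv_mulmx_ge vx => _ [i _ <-].
  by rewrite -subr_ge0 opprK (barycentric_vertex _ _ bN).
rewrite -lerBrDr; apply: conv_mulmx_le vx => _ [i _ <-].
by rewrite lerBrDr (barycentric_vertex _ _ bN) lern1 leq_b1.
Qed.

Lemma vmx_free n (v : 'I_n.+1 -> 'rV[int]_n) N k (z : 'cV[int]_n) :
  barycentric v N k -> vmx v *m z = 0 -> z = 0.
Proof.
move=> [_ NV _ _ _] /(congr1 (map_mx (intr : int -> rat))).
rewrite map_mxM map_mx0 => /(congr1 (mulmx N)).
rewrite mulmxA NV mul1mx mulmx0 => /colP z0; apply/colP => i.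
by move: (z0 i); rewrite !mxE => /eqP; rewrite intr_eq0 => /eqP.
Qed.

(** * Slices at extremal heights *)

Lemma slice_height n (w : 'cV[int]_n) h P x : slice w h P x -> height w x = h.
Proof.
move=> sx; apply/eqP; rewrite eq_le; apply/andP; split.
  by apply: conv_mulmx_le sx => y [[yh _] _]; rewrite -[leLHS]/(height w y) yh.
by apply: conv_mulmx_ge sx => y [[yh _] _]; rewrite -[leRHS]/(height w y) yh.
Qed.

Lemma slice_barycentric n (w : 'cV[int]_n) h v N k (x : 'rV[rat]_n) l :
  barycentric v N k -> slice w h (simplex v) x ->
  0 <= (x *m N) 0 l + k 0 l <= 1.
Proof.
move=> bN sx; apply/andP; split.
  rewrite -lerBlDr sub0r; apply: conv_mulmx_ge sx => y [[_ Py] _].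
  by rewrite -subr_ge0 opprK; case/andP: (barycentric_conv l bN Py).
rewrite -lerBrDr; apply: conv_mulmx_le sx => y [[_ Py] _].
by rewrite lerBrDr; case/andP: (barycentric_conv l bN Py).
Qed.

(* [e = 1] for a lowest face, [e = -1] for a highest one *)
Lemma extremal_support n (w : 'cV[int]_n) v N k (e h : rat) (x : 'rV[rat]_n) l :
  barycentric v N k -> (forall j, 0 <= e * (height w (toQ (v j)) - h)) ->
  slice w h (simplex v) x -> e != 0 -> height w (toQ (v l)) != h ->
  (x *m N) 0 l + k 0 l = 0.
Proof.
move=> bN eh sx e0 hl.
(* The height of [x] is the barycentric average of the heights of the vertices and equals [h], so
   these nonnegative terms add up to 0. *)
have S : \sum_j ((x *m N) 0 j + k 0 j) * (e * (height w (toQ (v j)) - h)) = 0.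
  have [_ _ _ xN k1] := bN.
  under eq_bigr do rewrite mulrCA mulrBr mulrBr.
  rewrite sumrB -!mulr_sumr -mulr_suml big_split /= xN k1 add0r mul1r.
  rewrite -(slice_height sx) {2}(barycentric_sum x bN) /height mulmx_suml summxE.
  apply/eqP; rewrite subr_eq0; apply/eqP; congr (_ * _); apply: eq_bigr => j _.
  by rewrite -scalemxAl !mxE.
have /psumr_eq0P S0 := S.
have /eqP : ((x *m N) 0 l + k 0 l) * (e * (height w (toQ (v l)) - h)) = 0.
  by apply: S0 => // j _; rewrite mulr_ge0//; case/andP: (slice_barycentric j bN sx).
by rewrite !mulf_eq0 (negPf e0) subr_eq0 (negPf hl) !orbF => /eqP.
Qed.

Lemma slice_face n (w : 'cV[int]_n) v N k (e h : rat) :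
  barycentric v N k -> (forall j, 0 <= e * (height w (toQ (v j)) - h)) ->
  e != 0 ->
  slice w h (simplex v) =
    conv [set toQ (v i) | i in [set i | height w (toQ (v i)) = h]].
Proof.
move=> bN eh e0; apply/seteqP; split; last first.
  apply: conv_mono => _ [i ih <-]; split; last by exists (v i).
  by split=> //; apply: sub_conv; exists i.
move=> x sx.
have [i ih] : exists i, height w (toQ (v i)) == h.
  apply/existsP; apply: contraTT isT; rewrite negb_exists => /forallP hn.
  have [_ _ _ xN k1] := bN.
  have : \sum_l ((x *m N) 0 l + k 0 l) = 1 by rewrite big_split /= xN k1 add0r.
  rewrite big1 => [/eqP|l _]; first by rewrite eq_sym oner_eq0.
  exact: (extremal_support bN eh sx e0 (hn l)).
(* Vertices off the face have coordinate 0 and may be replaced by the vertex [i] of the face. *)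
exists n.+1, (fun l => (x *m N + k) 0 l),
  (fun l => toQ (v (if height w (toQ (v l)) == h then l else i))).
split.
- by move=> l; rewrite mxE; case/andP: (slice_barycentric l bN sx).
- have [_ _ _ xN k1] := bN.
  by under eq_bigr do rewrite mxE; rewrite big_split /= xN k1 add0r.
- by move=> l; eexists; [|reflexivity]; rewrite /=; case: ifP => [/eqP|_]//; apply/eqP.
- rewrite {1}(barycentric_sum x bN); apply: eq_bigr => l _; case: ifPn => // hl.
  by rewrite mxE (extremal_support bN eh sx e0 hl) !scale0r.
Qed.

Lemma hmin_simplex n (w : 'cV[int]_n) v i :
  (forall j, height w (toQ (v i)) <= height w (toQ (v j))) ->
  hmin w (simplex v) = height w (toQ (v i)).
Proof.
move=> le_i; apply: xget_unique.
  split; first by exists (toQ (v i)) => //; apply: sub_conv; exists i.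
  by move=> _ [x Px <-]; apply: conv_mulmx_ge Px => _ [j _ <-]; apply: le_i.
move=> y [[x Px <-] xmin]; apply/eqP; rewrite eq_le; apply/andP; split.
  by apply: xmin; exists (toQ (v i)) => //; apply: sub_conv; exists i.
by apply: conv_mulmx_ge Px => _ [j _ <-]; apply: le_i.
Qed.

Lemma hmax_simplex n (w : 'cV[int]_n) v i :
  (forall j, height w (toQ (v j)) <= height w (toQ (v i))) ->
  hmax w (simplex v) = height w (toQ (v i)).
Proof.
move=> le_i; apply: xget_unique.
  split; first by exists (toQ (v i)) => //; apply: sub_conv; exists i.
  by move=> _ [x Px <-]; apply: conv_mulmx_le Px => _ [j _ <-]; apply: le_i.
move=> y [[x Px <-] xmax]; apply/eqP; rewrite eq_le; apply/andP; split.
  by apply: conv_mulmx_le Px => _ [j _ <-]; apply: le_i.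
by apply: xmax; exists (toQ (v i)) => //; apply: sub_conv; exists i.
Qed.

(** * The shape of a factor *)

(** The last hypothesis places [g i + b *: y] in the bottom face for all [y] in [F]. As [y = f i]
    gives the vertex [v i], the point [f i] minimizes over [F] every coordinate but the [i]-th, and
    coordinates outside [I] are constant on [F]. *)
Lemma factor_shape n (v : 'I_n.+1 -> 'rV[int]_n) N k (I : {set 'I_n.+1})
    (F : set 'rV[rat]_n) (b : rat) (f g : 'I_n.+1 -> 'rV[rat]_n) i0 :
  barycentric v N k -> 0 < b -> i0 \in I -> ~ is_point F ->
  (forall i, i \in I -> F (f i) /\ toQ (v i) = g i + b *: f i) ->
  (forall i y l, i \in I -> F y ->
    0 <= ((g i + b *: y) *m N) 0 l + k 0 l /\
    (l \notin I -> ((g i + b *: y) *m N) 0 l + k 0 l = 0)) ->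
  exists (m : 'rV[rat]_n.+1) (c : rat) (i1 : 'I_n.+1),
  [/\ 0 < c, i1 \in I /\ i1 != i0,
    forall i l, i \in I -> (f i *m N) 0 l = m 0 l + c * (l == i)%:R,
    forall y l, F y -> m 0 l <= (y *m N) 0 l
  & forall y l, F y -> l \notin I -> (y *m N) 0 l = m 0 l].
Proof.
move=> bN b0 i0I Fnp fI gI; have [_ NV _ xN _] := bN.
have injN (x y : 'rV[rat]_n) : x *m N = y *m N -> x = y.
  by move=> /(congr1 (mulmx^~ (vmxQ v))); rewrite -!mulmxA NV !mulmx1.
have gE i y l : i \in I -> ((g i + b *: y) *m N) 0 l + k 0 l =
    (l == i)%:R + b * ((y *m N) 0 l - (f i *m N) 0 l).
  move=> iI; have -> : g i = toQ (v i) - b *: f i by rewrite (fI i iI).2 addrK.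
  rewrite -(barycentric_vertex i l bN) mulmxDl mulmxBl -!scalemxAl !mxE.
  by rewrite -!/((_ *m _) _ _); ring.
have f_min i y l : i \in I -> F y -> l != i -> (f i *m N) 0 l <= (y *m N) 0 l.
  move=> iI Fy li; have [+ _] := gI i y l iI Fy.
  by rewrite gE// (negPf li) add0r pmulr_rge0// subr_ge0.
have f_eq i y l : i \in I -> F y -> l \notin I -> (y *m N) 0 l = (f i *m N) 0 l.
  move=> iI Fy lI; have li : l != i by apply: contraNneq lI => ->.
  have [_ /(_ lI)/eqP] := gI i y l iI Fy.
  by rewrite gE// (negPf li) add0r mulf_eq0 gt_eqF//= subr_eq0 => /eqP.
have [y Fy yf] : exists2 y, F y & y != f i0.
  apply: contrapT => F1; apply: Fnp; exists (f i0); apply/seteqP; split.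
    by move=> y Fy; apply/eqP/negP => yf; apply: F1; exists y => //; apply/negP.
  by move=> _ ->; case: (fI i0 i0I).
(* Linear parts of barycentric coordinates sum to 0, so distinct points differ in a coordinate other
   than [i0]. *)
have [i1 i10 yi1] : exists2 i1, i1 != i0 & (f i0 *m N) 0 i1 != (y *m N) 0 i1.
  apply: contrapT => E; case/eqP: yf; apply: injN.
  have {}E l : l != i0 -> (y *m N) 0 l = (f i0 *m N) 0 l.
    move=> li; apply/eqP; rewrite eq_sym; apply/negP => /negP ne.
    by apply: E; exists l.
  apply/rowP => l; have [->|/E//] := eqVneq l i0.
  have := etrans (xN y) (esym (xN (f i0))).
  by rewrite (bigD1 i0) //= [RHS](bigD1 i0) //= (eq_bigr _ E) => /addIr.
have i1I : i1 \in I.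
  by apply: contraNT yi1 => /(f_eq i0 y i1 i0I Fy) ->.
(* An index of [I] other than [l], so that [f (p l)] minimizes coordinate [l]. *)
pose p l := if l == i0 then i1 else i0.
have pI l : p l \in I by rewrite /p; case: ifP.
have pN l : l != p l.
  by rewrite /p; have [->|//] := eqVneq l i0; rewrite eq_sym.
pose m := \row_l (f (p l) *m N) 0 l.
have mE i l : i \in I -> l != i -> (f i *m N) 0 l = m 0 l.
  move=> iI li; rewrite [RHS]mxE; apply/eqP; rewrite eq_le.
  by rewrite !f_min//; apply: (fI _ _).1.
have m_min z l : F z -> m 0 l <= (z *m N) 0 l by move=> Fz; rewrite mxE f_min.
(* Zero coordinate sums force this excess of coordinate [i] of [f i] over its minimum, the same for
   every [i]. *)
pose c := - \sum_l m 0 l.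
exists m, c, i1; split=> //.
- have -> : c = \sum_l (y *m N) 0 l - \sum_l m 0 l by rewrite xN sub0r.
  rewrite -sumrB (bigD1 i1)//= ltr_pwDl//.
    by rewrite subr_gt0 lt_neqAle m_min// andbT; move: yi1; rewrite (mE i0 i1).
  by apply: sumr_ge0 => l _; rewrite subr_ge0 m_min.
- move=> i l iI; have [->|li] := eqVneq l i; last by rewrite /= mulr0 addr0 mE.
  have S : \sum_(j | j != i) (f i *m N) 0 j = \sum_(j | j != i) m 0 j.
    by apply: eq_bigr => j ji; rewrite mE.
  have := xN (f i); rewrite (bigD1 i)//= S => /eqP; rewrite addr_eq0 => /eqP ->.
  by rewrite /= mulr1 /c [in RHS](bigD1 i)//= opprD addNKr.
- by move=> z l Fz lI; rewrite [RHS]mxE (f_eq (p l)).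
Qed.

(** * Weight relations and signs of the heights *)

Lemma mulmxDZ_entry (R : comPzRingType) m n p (x y : 'M[R]_(m, n)) (a : R)
    (B : 'M[R]_(n, p)) i j :
  ((x + a *: y) *m B) i j = (x *m B) i j + a * (y *m B) i j.
Proof. by rewrite mulmxDl -scalemxAl mxE; congr (_ + _); rewrite mxE. Qed.

Lemma weights_sumQ n (v : 'I_n.+1 -> 'rV[int]_n) lam :
  weights v lam -> \sum_i (lam i)%:R *: toQ (v i) = 0.
Proof.
move=> [_ _ /(congr1 (@toQ n))]; rewrite /toQ map_mx0 => E.
rewrite -[RHS]E raddf_sum; apply: eq_bigr => i _.
apply/rowP => j; rewrite [LHS]mxE [X in _ * X]mxE [RHS]mxE mulmxnE.
by rewrite raddfMn mulr_natl.
Qed.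

Lemma weights_sum_height n (v : 'I_n.+1 -> 'rV[int]_n) lam (w : 'cV[int]_n) :
  weights v lam -> \sum_i (lam i)%:R * height w (toQ (v i)) = 0.
Proof.
move=> /weights_sumQ/(congr1 (height w)).
rewrite {1 2}/height mulmx_suml summxE mul0mx [X in _ = X]mxE => hS.
rewrite -[RHS]hS; apply: eq_bigr => i _.
by rewrite -scalemxAl [RHS]mxE.
Qed.

(** A primitive [w] is nonzero, so the heights do not all vanish; their combination with positive
    weights does, so both signs occur. *)
Lemma extremal_heights n (v : 'I_n.+1 -> 'rV[int]_n) lam (w : 'cV[int]_n) N k :
  barycentric v N k -> weights v lam -> primitive w ->
  exists i0 t,
    [/\ forall j, height w (toQ (v i0)) <= height w (toQ (v j)),
        forall j, height w (toQ (v j)) <= height w (toQ (v t)),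
        height w (toQ (v i0)) < 0 & 0 < height w (toQ (v t))].
Proof.
move=> bN lamP wP; pose h j := height w (toQ (v j)).
have [i0 _ i0min] := @arg_minP _ rat _ ord0 xpredT h isT.
have [t _ tmax] := @arg_maxP _ rat _ ord0 xpredT h isT.
have hS := weights_sum_height w lamP; have [lam0 _ _] := lamP.
have [j hj] : exists j, h j != 0.
  apply/existsP; apply: contraTT isT; rewrite negb_exists => /forallP h0.
  have w0 : w = 0.
    apply: (vmx_free bN); apply/colP => j; rewrite [RHS]mxE.
    move: (h0 j); rewrite negbK /h height_toQ intr_eq0 => /eqP <-.
    by rewrite !mxE; apply: eq_bigr => l _; rewrite mxE.
  by have := wP 0 w; rewrite scale0r => /(_ w0).
exists i0, t; split=> [l|l||]; first exact: i0min; first exact: tmax.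
- rewrite ltNge; apply: contra hj => i0_ge0.
  have /(_ j isT)/eqP := psumr_eq0P (fun l _ => mulr_ge0 (ler0n _ (lam l))
    (le_trans i0_ge0 (i0min l isT))) hS.
  by rewrite mulf_eq0 pnatr_eq0 (gtn_eqF (lam0 j)).
- rewrite ltNge; apply: contra hj => t_le0.
  have hS' : \sum_i (lam i)%:R * - h i = 0.
    by under eq_bigr do rewrite mulrN; rewrite sumrN hS oppr0.
  have hN0 l : 0 <= - h l by rewrite oppr_ge0 (le_trans _ t_le0)//; apply: tmax.
  have /(_ j isT)/eqP := psumr_eq0P (fun l _ => mulr_ge0 (ler0n _ (lam l)) (hN0 l)) hS'.
  by rewrite mulf_eq0 pnatr_eq0 (gtn_eqF (lam0 j)) oppr_eq0.
Qed.

(** * Vertices of the mutated simplex *)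

(** The permutation [s] pairs the vertices of Q with those of P so that, apart from [t], passing
    from one to the other is a scaling and a reflection, as the determinant comparison requires. *)
Lemma mutation_vertices n (v u : 'I_n.+1 -> 'rV[int]_n) lam (w : 'cV[int]_n)
    (F : set 'rV[rat]_n) :
  full_dim (simplex v) -> vert (simplex v) = [set toQ (v i) | i in setT] ->
  weights v lam -> ~ is_point F -> is_mutation w (simplex v) F (simplex u) ->
  exists (I : {set 'I_n.+1}) (t : 'I_n.+1) (s : 'S_n.+1) (a b : rat),
  [/\ [/\ 0 < a, 0 < b, t \notin I & I != finset.set0],
      forall j, height w (toQ (v j)) =
        if j == t then a else if j \in I then - b else 0,
      height w (toQ (u (s t))) = - b
    & forall j, j != t -> toQ (u (s j)) =
        if j \in I then toQ (v t) + (a / b) *: (toQ (v j) - toQ (u (s t)))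
        else toQ (v j)].
Proof.
move=> vdim vertP lamP Fnp [wP [_ Fh _] [G GP QE]].
have [N [k bN]] := barycentric_ex vdim.
have [i0 [t [i0min tmax i0neg tpos]]] := extremal_heights bN lamP wP.
have [_ NV kV xN k1] := bN.
have hminE := hmin_simplex i0min; have hmaxE := hmax_simplex tmax.
pose hz j : int := (v j *m w) 0 0.
have hzE j : (hz j)%:~R = height w (toQ (v j)) :> rat by rewrite height_toQ.
pose I := finset (fun i => hz i == hz i0).
have IP i : i \in I -> height w (toQ (v i)) = height w (toQ (v i0)).
  by rewrite finset.inE -!hzE => /eqP ->.
have i0I : i0 \in I by rewrite finset.inE.
pose b : rat := - (hz i0)%:~R; pose a : rat := (hz t)%:~R.
have b0 : 0 < b by rewrite oppr_gt0 hzE.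
have a0 : 0 < a by rewrite /a hzE.
have tI : t \notin I by apply: contraTN tpos => /IP ->; rewrite -leNgt ltW.
have low j : j \notin I -> - b < height w (toQ (v j)).
  move=> jI; rewrite /b opprK hzE lt_neqAle i0min andbT -!hzE eqr_int eq_sym.
  by move: jI; rewrite finset.inE.
have Gdec (j : 'I_n.+1) : height w (toQ (v j)) < 0 ->
    exists y z, [/\ G (hz j) y, F z & toQ (v j) = y + (- (hz j)%:~R) *: z].
  move=> hj; have [||_ + _] := GP (hz j); first by rewrite hminE hzE.
    by rewrite -(ltrz0 rat) hzE.
  move/(_ (toQ (v j))) => [].
    split; first by rewrite /hyperplane /= hzE.
    by rewrite vertP; exists j.
  by move=> y Gy [_ [z Fz <-] <-]; exists y, z.
have [gf gfP] : exists gf : 'I_n.+1 -> 'rV[rat]_n * 'rV[rat]_n,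
    forall i, i \in I ->
      [/\ G (hz i0) (gf i).1, F (gf i).2 & toQ (v i) = (gf i).1 + b *: (gf i).2].
  suff /choice[gf gfP] : forall i, exists p : 'rV[rat]_n * 'rV[rat]_n, i \in I ->
      [/\ G (hz i0) p.1, F p.2 & toQ (v i) = p.1 + b *: p.2] by exists gf.
  move=> i; case: (boolP (i \in I)) => [iI|]; last by exists (0, 0).
  have [|y [z [Gy Fz E]]] := Gdec i; first by rewrite IP.
  have hi : hz i = hz i0 by apply/eqP; move: iI; rewrite finset.inE.
  by exists (y, z) => _; split; rewrite /b -?hi.
pose g i := (gf i).1; pose f i := (gf i).2.
have [m [c [i1 [c0 [i1I i10] fm m_min m_eq]]]] :
  exists (m : 'rV[rat]_n.+1) (c : rat) (i1 : 'I_n.+1),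
  [/\ 0 < c, i1 \in I /\ i1 != i0,
    forall i l, i \in I -> (f i *m N) 0 l = m 0 l + c * (l == i)%:R,
    forall y l, F y -> m 0 l <= (y *m N) 0 l
  & forall y l, F y -> l \notin I -> (y *m N) 0 l = m 0 l].
  apply: (factor_shape (g := g) bN b0 i0I Fnp) => [i /gfP[]//|i y l iI Fy].
  have [||_ _ Gsl] := GP (hz i0); first by rewrite hminE hzE.
    by rewrite -(ltrz0 rat) hzE.
  have sl : slice w (hz i0)%:~R (simplex v) (g i + b *: y).
    by apply: Gsl; exists (g i); [case: (gfP i iI)|exists (b *: y) => //; exists y].
  split; first by case/andP: (slice_barycentric l bN sl).
  move=> lI; apply: (extremal_support (e := 1) bN _ sl) => //.
    by move=> j; rewrite mul1r subr_ge0 hzE.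
  by rewrite -hzE eqr_int; move: lI; rewrite finset.inE.
(* The linear part of psi: subtracting [m] once per unit of height compensates the multiples of [F]
   that the mutation adds or removes. *)
pose B := N - map_mx intr w *m m.
have BE y l : (y *m B) 0 l = (y *m N) 0 l - height w y * m 0 l.
  rewrite /B mulmxBr mulmxA !mxE; congr (_ - _).
  by rewrite big_ord1 /height !mxE.
pose psi (y : 'rV[rat]_n) l := (y *m B) 0 l + k 0 l.
have psiE y l : psi y l = (y *m N) 0 l + k 0 l - height w y * m 0 l.
  by rewrite /psi BE addrAC.
(* The middle term is a barycentric coordinate of [y - h z], a point of the slice; a [z] minimizing
   coordinate [l] then bounds [psi y l] itself. *)
have psi_G (h : int) y z l : hmin w (simplex v) <= h%:~R -> h < 0 -> G h y -> F z ->
    0 <= psi y l + - h%:~R * ((z *m N) 0 l - m 0 l) <= 1.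
  move=> hh h0 Gy Fz; have [_ _ Gsl] := GP h hh h0.
  have sl : slice w h%:~R (simplex v) (y + (- h%:~R) *: z).
    by apply: Gsl; exists y => //; exists ((- h%:~R) *: z) => //; exists z.
  have := slice_barycentric l bN sl; have := slice_height sl.
  rewrite heightD heightZ (Fh z Fz) mulr0 addr0 psiE => ->.
  rewrite mulmxDZ_entry.
  suff -> : forall p q r s h : rat, p + q - h * r + - h * (s - r) = p + - h * s + q by [].
  by move=> *; ring.
have psi_slice (h : rat) y z l : slice w h (simplex v) y -> F z ->
    psi (y + h *: z) l = (y *m N) 0 l + k 0 l + h * ((z *m N) 0 l - m 0 l).
  move=> sl Fz; rewrite psiE heightD heightZ (Fh z Fz) mulr0 addr0 (slice_height sl).
  rewrite mulmxDZ_entry.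
  by ring.
have f_spec l : exists2 z, F z & (z *m N) 0 l = m 0 l.
  have [li|li] := eqVneq l i0.
    exists (f i1); first by case: (gfP i1 i1I).
    by rewrite fm// li eq_sym (negPf i10) mulr0 addr0.
  exists (f i0); first by case: (gfP i0 i0I).
  by rewrite fm// (negPf li) mulr0 addr0.
rewrite /mut in QE; set A := (X in _ = conv X) in QE.
have psi_A y l : A y -> 0 <= psi y l /\ (l \notin I -> psi y l <= 1).
  case=> [[h [hh h0] Gy]|[h [h0 hh] [p sl [_ [z Fz <-] <-]]]].
    have [z Fz zm] := f_spec l; have := psi_G h y z l hh h0 Gy Fz.
    by rewrite zm subrr mulr0 addr0 => /andP[].
  rewrite psi_slice//; have /andP[p0 p1] := slice_barycentric l bN sl; split.
    by rewrite addr_ge0// mulr_ge0 ?ler0z// subr_ge0 m_min.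
  by move=> lI; rewrite (m_eq z)// subrr mulr0 addr0.
have psi_ge0 y l : simplex u y -> 0 <= psi y l.
  rewrite QE /psi -[k 0 l]opprK subr_ge0 => Qy.
  apply: conv_mulmx_ge Qy => z /(psi_A _ l)[+ _].
  by rewrite /psi -[k 0 l]opprK subr_ge0 opprK.
have psi_le1 y l : l \notin I -> simplex u y -> psi y l <= 1.
  move=> lI; rewrite QE /psi -lerBrDr; apply: conv_mulmx_le => z /(psi_A _ l)[_ /(_ lI)].
  by rewrite lerBrDr.
(* If the values agree off [i], zero coordinate sums make the difference a multiple of [f i] by its
   own height, which is 0 because [F] has height 0. *)
have psi_inj i y y' : i \in I -> (forall l, l != i -> psi y l = psi y' l) -> y = y'.
  move=> iI eqpsi; pose z := y - y'.
  have zN l : l != i -> (z *m N) 0 l = height w z * (f i *m N) 0 l.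
    move=> li; rewrite fm// (negPf li) mulr0 addr0; apply/eqP.
    rewrite -subr_eq0 -BE mulmxBl mxE [X in _ + X]mxE subr_eq0.
    by have := eqpsi l li; rewrite /psi => /addIr ->.
  have {}zN : z *m N = (height w z *: f i) *m N.
    rewrite -scalemxAl; apply/rowP => l; rewrite [RHS]mxE.
    have [->|/zN//] := eqVneq l i.
    have := etrans (xN z) (esym (xN (height w z *: f i))).
    rewrite (bigD1 i)//= [RHS](bigD1 i)//= -scalemxAl [in RHS]mxE.
    have -> : \sum_(j | j != i) (z *m N) 0 j =
              \sum_(j | j != i) (height w z *: (f i *m N)) 0 j.
      by apply: eq_bigr => j /zN ->; rewrite [RHS]mxE.
    by move/addIr.
  have zf : z = height w z *: f i.
    by rewrite -[LHS]mulmx1 -[RHS]mulmx1 -NV !mulmxA zN.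
  have [_ Ffi _] := gfP i iI.
  have z0 : height w z = 0 by rewrite zf heightZ (Fh (f i))// mulr0.
  by apply/eqP; rewrite -subr_eq0 -/z zf z0 scale0r.
have vertexP y i : simplex u y -> i \in I ->
    (forall l, l != i -> psi y l = 0 \/ (l \notin I /\ psi y l = 1)) ->
    exists j, y = toQ (u j).
  move=> Qy iI y01.
  (* The sign is 1 where psi reaches its upper bound 1 and -1 where it reaches 0; coordinate [i] is
     left out, the others determining the point. *)
  pose e : 'cV[rat]_n.+1 := \col_l (if l == i then 0 else if psi y l == 1 then 1 else - 1).
  have eE x : (x *m (B *m e)) 0 0 = \sum_l psi x l * e l 0 - \sum_l k 0 l * e l 0.
    rewrite mulmxA mxE -sumrB; apply: eq_bigr => l _.
    by rewrite /psi mulrDl addrK.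
  have le_e x l : simplex u x -> psi x l * e l 0 <= psi y l * e l 0.
    move=> Qx; rewrite mxE; case: eqVneq => [_|li]; first by rewrite !mulr0.
    case: eqP => [y1|y1]; last first.
      case: (y01 l li) => [->|[_ /y1//]].
      by rewrite mul0r mulrN1 oppr_le0 psi_ge0.
    case: (y01 l li) => [/eqP|[lI _]]; last by rewrite y1 !mulr1 psi_le1.
    by rewrite y1 oner_eq0.
  have eq_e x l : simplex u x -> psi x l * e l 0 = psi y l * e l 0 -> l != i ->
      psi x l = psi y l.
    move=> Qx + li; rewrite mxE (negPf li).
    by case: ifP => _ /mulIf; apply; rewrite ?oppr_eq0 oner_eq0.
  have Uu x : [set toQ (u j) | j in setT] x -> simplex u x by exact: sub_conv.
  have [j _ <-] : [set toQ (u j) | j in setT] y; last by exists j.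
  apply: (conv_strict_max (z := B *m e)) => // x /Uu Qx; rewrite !eE.
    by rewrite lerB// ler_sum// => l _; apply: le_e.
  move/addIr => E; apply: (psi_inj i) => // l; apply: eq_e => //.
  have /psumr_eq0P D : \sum_l (psi y l * e l 0 - psi x l * e l 0) = 0.
    by rewrite sumrB E subrr.
  by apply/esym/eqP; rewrite -subr_eq0 D// => j _; rewrite subr_ge0 le_e.
pose h j := height w (toQ (v j)).
(* Otherwise the [F]-part [z] of [v j] attains all the minima at once, while its coordinates sum to
   0 and the minima to [- c]. *)
have h_ge0 j : j \notin I -> 0 <= h j.
  move=> jI; rewrite leNgt; apply/negP => hj.
  have [y [z [Gy Fz E]]] := Gdec j hj.
  have zm l : (z *m N) 0 l = m 0 l.
    have [lI|] := boolP (l \in I); last exact: m_eq.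
    apply/eqP; rewrite eq_le m_min// andbT.
    have lj : (l == j) = false by apply: contraNF jI => /eqP <-.
    have [z' Fz' z'm] := f_spec l.
    have /andP[+ _] : 0 <= psi y l + - (hz j)%:~R * ((z' *m N) 0 l - m 0 l) <= 1.
      by apply: psi_G => //; rewrite ?hminE ?hzE// -(ltrz0 rat) hzE.
    have -> : y = toQ (v j) + (hz j)%:~R *: z by rewrite E -addrA -scalerDl addNr scale0r addr0.
    rewrite z'm subrr mulr0 addr0 psiE heightD heightZ (Fh z Fz) mulr0 addr0.
    rewrite mulmxDZ_entry [X in X - _]addrAC (barycentric_vertex _ _ bN) lj add0r hzE -mulrBr.
    by rewrite nmulr_rge0// subr_le0.
  have : \sum_l (f i0 *m N) 0 l = \sum_l (z *m N) 0 l + c.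
    under eq_bigr do rewrite fm//.
    rewrite big_split /=; congr (_ + _); first by apply: eq_bigr => l _.
    by rewrite (bigD1 i0)//= eqxx mulr1 big1 ?addr0// => l /negPf ->; rewrite mulr0.
  by rewrite !xN add0r => c00; rewrite -c00 ltxx in c0.
pose x j i := toQ (v j) + h j *: f i.
have psi_x j i l : i \in I -> psi (x j i) l = (l == j)%:R + h j * c * (l == i)%:R.
  move=> iI; rewrite psiE heightD heightZ (Fh (f i)) ?mulr0 ?addr0; last by case: (gfP i iI).
  by rewrite mulmxDZ_entry [X in X - _]addrAC (barycentric_vertex _ _ bN) fm// -/(h j); ring.
have hI i : i \in I -> h i = - b by move=> iI; rewrite /h IP// -hzE opprK.
(* For [j] in [I] the point is [g i], taken from the lowest remainder; otherwise it lies in a slice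
   plus a multiple of [F]. *)
have x_vertex j i : i \in I -> (j \in I -> j = i) -> exists p, x j i = toQ (u p).
  move=> iI ji; have [Ggi Ffi viE] := gfP i iI.
  apply: (vertexP _ i) => //; last first.
    move=> l li; rewrite psi_x// (negPf li) mulr0 addr0.
    have [lj|] := eqVneq l j; [right|by left].
    by split=> //; apply: contraNN li => lI; rewrite lj ji -?lj.
  rewrite QE; apply: sub_conv.
  have [jI|jI] := boolP (j \in I).
    left; exists (hz i0); first by split; [rewrite hminE hzE|rewrite -(ltrz0 rat) hzE].
    by rewrite /x (hI j jI) ji// viE -addrA -scalerDl addrN scale0r addr0.
  right; exists (hz j); first by split; [rewrite -(ler0z rat) hzE; apply: h_ge0|rewrite hmaxE hzE].
  exists (toQ (v j)).
    apply: sub_conv; split; last by exists (v j).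
    by split; [rewrite /hyperplane /= hzE|apply: sub_conv; exists j].
  by exists (h j *: f i); rewrite // hzE; exists (f i).
pose pt j := if j \in I then x t j else if j == t then x i0 i0 else x j i0.
have pt_vertex j : exists p, pt j = toQ (u p).
  rewrite /pt; case: ifP => jI; last case: ifP => jt.
  - by apply: x_vertex => //; rewrite (negPf tI).
  - exact: x_vertex.
  - by apply: x_vertex => //; rewrite jI.
have htE : h t = a by rewrite /a hzE.
have i0t : (i0 == t) = false by apply: contraNF tI => /eqP <-.
have ti0 : (t == i0) = false by rewrite eq_sym.
have nIi j i : j \notin I -> i \in I -> (j == i) = false.
  by move=> jI iI; apply: contraNF jI => /eqP ->.
have psi_pt j l : psi (pt j) l =
   if j \in I then (l == t)%:R + a * c * (l == j)%:R
   else if j == t then (1 - b * c) * (l == i0)%:R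
   else (l == j)%:R + h j * c * (l == i0)%:R.
  rewrite /pt; case: ifP => jI; last case: ifP => jt; rewrite psi_x// ?htE//.
  by rewrite hI//; ring.
have ac0 : a * c != 0 by rewrite mulf_neq0 ?gt_eqF.
(* Coordinate [t] separates the points indexed by [I] from the others. *)
have psi_t j : psi (pt j) t = (j \in I)%:R.
  rewrite psi_pt eqxx ti0 !mulr0 addr0; case: ifP => [jI|_].
    by rewrite (nIi t j) ?mulr0 ?addr0.
  by case: eqVneq => // jt; rewrite eq_sym (negPf jt).
have pt_inj : injective pt.
  move=> j l E; have := psi_t j; rewrite E psi_t.
  have P p : psi (pt j) p = psi (pt l) p by rewrite E.
  have [lI|lI] := boolP (l \in I); have [jI|jI] := boolP (j \in I) => //= _.
  - have := P j; rewrite !psi_pt lI jI eqxx (eq_sym j t) (nIi t j)//.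
    case: eqVneq => // _; rewrite mulr0 mulr1 add0r.
    by move/eqP; rewrite (negPf ac0).
  - have := P j; have := P l; rewrite !psi_pt (negPf lI) (negPf jI) !eqxx.
    rewrite (nIi j i0)// (nIi l i0)// !mulr0 !addr0.
    have [->|jt] := eqVneq j t; have [->|lt] := eqVneq l t => //.
    by case: (eqVneq l j) => // _ /eqP; rewrite eq_sym oner_eq0.
have /choice[s0 s0P] := pt_vertex.
have s0_inj : injective s0.
  by move=> j l E; apply: pt_inj; rewrite !s0P E.
pose s := perm s0_inj.
have sE j : toQ (u (s j)) = pt j by rewrite permE s0P.
have u_pt p : exists j, toQ (u p) = pt j.
  by exists ((s^-1)%g p); rewrite -sE permKV.
(* Among the listed vertices only [x i0 i0] can equal [x i1 i1]; coordinate [i1] then reads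
   [1 - b * c = 0]. *)
have bc1 : b * c = 1.
  have [p xp] := x_vertex i1 i1 i1I (fun=> erefl).
  have [j uj] := u_pt p; rewrite uj in xp.
  have P l : (1 - b * c) * (l == i1)%:R = psi (pt j) l.
    by rewrite -xp psi_x// hI//; ring.
  have jI : j \notin I.
    by have := P t; rewrite psi_t (nIi t i1)// mulr0; case: (j \in I).
  have jt : j == t.
    apply: contraT => jt; have := P j; rewrite psi_pt (negPf jI) (negPf jt) eqxx.
    by rewrite !nIi// !mulr0 addr0 => /eqP; rewrite eq_sym oner_eq0.
  have := P i1; rewrite psi_pt (negPf jI) jt eqxx (negPf i10) mulr0 mulr1.
  by move/eqP; rewrite subr_eq0 => /eqP/esym.
(* Likewise [x j i1] can only be [x j i0], and coordinate [i1] reads [h j * c = 0]. *)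
have h0 j : j \notin I -> j != t -> h j = 0.
  move=> jI jt; have [p xp] := x_vertex j i1 i1I (fun jI' => False_ind _ (negP jI jI')).
  have [l ul] := u_pt p; rewrite ul in xp.
  have P q : (q == j)%:R + h j * c * (q == i1)%:R = psi (pt l) q by rewrite -xp psi_x.
  have lI : l \notin I.
    have := P t; rewrite psi_t (nIi t i1)// mulr0 addr0 eq_sym (negPf jt).
    by case: (l \in I) => // /eqP; rewrite eq_sym oner_eq0.
  have lt : l != t.
    apply/negP => lt; have := P j; rewrite psi_pt (negPf lI) lt eqxx !nIi// !mulr0 addr0.
    by move/eqP; rewrite oner_eq0.
  have := P l; rewrite psi_pt (negPf lI) (negPf lt) eqxx (nIi l i1)// (nIi l i0)// !mulr0 !addr0.
  case: (eqVneq l j) => [lj _|_ /eqP]; last by rewrite eq_sym oner_eq0.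
  have := P i1; rewrite psi_pt (negPf lI) (negPf lt) lj eqxx (negPf i10) !mulr0 mulr1.
  by move=> /addrI/eqP; rewrite mulf_eq0 (gt_eqF c0) orbF => /eqP.
exists I, t, s, a, b; split.
- by split=> //; apply/finset.set0Pn; exists i0.
- move=> j; rewrite -/(h j); case: eqVneq => [->//|jt].
  by case: ifPn => jI; [rewrite hI|rewrite h0].
- rewrite sE /pt (negPf tI) eqxx /x heightD heightZ (Fh (f i0)).
    by rewrite mulr0 addr0 -/(h i0) hI.
  by case: (gfP i0 i0I).
- move=> j jt; rewrite !sE /pt (negPf tI) eqxx (negPf jt).
  case: ifPn => jI; last by rewrite /x h0// scale0r addr0.
  (* Since [b * c = 1], psi vanishes at [x j j] for every [j] in [I], so all these points
     coincide. *)
  have -> : x i0 i0 = x j j.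
    apply: (psi_inj i0) => // l li; rewrite !psi_x// !hI// mulNr bc1 !mulN1r.
    by rewrite !subrr.
  rewrite {1}/x htE; congr (_ + _); rewrite /x hI// opprD addrA subrr add0r.
  by rewrite scaleNr opprK scalerA divfK// gt_eqF.
Qed.

(** * Relabelling and uniqueness of weights *)

Lemma simplex_perm n (v : 'I_n.+1 -> 'rV[int]_n) (s : 'S_n.+1) :
  simplex (fun i => v (s i)) = simplex v.
Proof.
congr conv; apply/seteqP; split=> _ [i _ <-]; first by exists (s i).
by exists ((s^-1)%g i); rewrite // permKV.
Qed.

Lemma weights_perm n (v : 'I_n.+1 -> 'rV[int]_n) l (s : 'S_n.+1) :
  weights v l -> weights (fun i => v (s i)) (fun i => l (s i)).
Proof.
move=> [l0 l1 lS]; split=> //.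
  by rewrite -[RHS]l1 [RHS](reindex_inj (@perm_inj _ s)).
by rewrite -[RHS]lS [RHS](reindex_inj (@perm_inj _ s)).
Qed.

Lemma enumerating_perm n (I : {set 'I_n.+1}) (t : 'I_n.+1) : t \notin I ->
  exists s : 'S_n.+1, s ord0 = t /\ forall i, (s i \in I) = (1 <= i <= #|I|)%N.
Proof.
move=> tI; pose J := finset.setC (t |: I)%SET.
pose e := t :: enum I ++ enum J.
have e_uniq : uniq e.
  rewrite /e /= cat_uniq !enum_uniq mem_cat !mem_enum (negPf tI) !finset.inE eqxx /=.
  rewrite andbT; apply/hasPn => j; rewrite !mem_enum !finset.inE => /norP[_].
  by [].
have e_size : size e = n.+1.
  have := cardsC (t |: I)%SET; rewrite cardsU1 tI card_ord -/J /= => E.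
  by rewrite -[RHS]E /e /= size_cat -!cardE.
pose s0 (i : 'I_n.+1) := nth t e i.
have s0_inj : injective s0.
  move=> i j /eqP; rewrite nth_uniq ?e_size// => /eqP; exact: val_inj.
exists (perm s0_inj); split=> [|i]; rewrite permE // /s0 /e.
case: i => [[|i] /= lti]; first exact: negPf.
rewrite nth_cat -cardE; case: ltnP => ik.
  by rewrite -mem_enum mem_nth// -cardE.
have : nth t (enum J) (i - #|I|) \in enum J.
  rewrite mem_nth// -cardE ltn_subLR//.
  by move: e_size lti; rewrite /e /= size_cat -!cardE => -[->].
by rewrite mem_enum !finset.inE => /norP[_ /negPf].
Qed.

Lemma weights_proportional n (u : 'I_n.+1 -> 'rV[int]_n) mu (W : 'I_n.+1 -> nat) :
  full_dim (simplex u) -> weights u mu -> (forall i, 0 < W i)%N ->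
  \sum_i (W i)%:R *: toQ (u i) = 0 ->
  exists2 d, (0 < d)%N & forall i, W i = (d * mu i)%N.
Proof.
move=> /barycentric_ex[N [k bN]] muP W0 WS; have muS := weights_sumQ muP.
have [mu0 mu1 _] := muP.
pose M := (\sum_i W i)%N; pose m := (\sum_i mu i)%N.
have m0 : (0 < m)%N by rewrite /m (bigD1 ord0)//= addn_gt0 mu0.
(* Scaled to equal totals, the two relations differ by one with coefficient sum 0, which affine
   independence annihilates. *)
have E i : (mu i * M = W i * m)%N.
  pose c := \row_i ((mu i * M)%:R - (W i * m)%:R : rat).
  have cu : c *m vmxQ u = 0.
    rewrite mul_vmxQ; under eq_bigr do rewrite mxE scalerBl !natrM.
    rewrite sumrB; under eq_bigr do rewrite mulrC -scalerA.
    rewrite -scaler_sumr muS scaler0 sub0r; under eq_bigr do rewrite mulrC -scalerA.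
    by rewrite -scaler_sumr WS scaler0 oppr0.
  have c1 : \sum_i c 0 i = 0.
    under eq_bigr do rewrite mxE !natrM.
    by rewrite sumrB -!mulr_suml -!natr_sum mulrC subrr.
  have : c = 0.
    have [bv _ _ _ _] := bN; rewrite [c]matrix_sum_delta big_ord1.
    have -> : \sum_j c 0 j *: delta_mx 0 j = (c *m vmxQ u) *m N + (\sum_j c 0 j) *: k.
      rewrite mul_vmxQ mulmx_suml scaler_suml -big_split; apply: eq_bigr => j _ /=.
      by rewrite -bv scalerDr scalemxAl.
    by rewrite cu c1 mul0mx scale0r addr0.
  by move/rowP/(_ i)/eqP; rewrite !mxE subr_eq0 eqr_nat => /eqP.
(* [m] divides every [mu i * M], hence their gcd, which is [M] by coprimality of [mu]. *)
have /dvdnP[d Md] : (m %| M)%N.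
  rewrite -[M]muln1 -mu1 (big_morph _ (muln_gcdr M) (muln0 M)).
  by apply/dvdn_biggcdP => i _; rewrite mulnC E dvdn_mull.
exists d.
  have : (0 < M)%N by rewrite /M (bigD1 ord0)//= addn_gt0 W0.
  by rewrite Md muln_gt0 => /andP[].
by move=> i; apply/eqP; rewrite -(eqn_pmul2r m0) -E Md; apply/eqP; lia.
Qed.

(** * Determinants under mutation *)

(** The matrix is an involution, so its determinant squares to 1. *)
Lemma det_reflection n (c : 'cV[rat]_n) (z : 'rV[rat]_n) :
  (z *m c) 0 0 = 2 -> `|\det (1%:M - c *m z)| = 1.
Proof.
move=> zc; have zcE : z *m c = 2%:M.
  by apply/matrixP => i j; rewrite !ord1 zc mxE eqxx.
have : (1%:M - c *m z) *m (1%:M - c *m z) = 1%:M.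
  rewrite mulmxBl mul1mx mulmxBr mulmx1 mulmxA -[c *m z *m c]mulmxA zcE.
  by rewrite mul_mx_scalar -scalemxAl scaler_nat mulr2n opprB addrK subrK.
move/(congr1 determinant); rewrite det_mulmx det1 => D.
by apply/eqP; rewrite -sqrp_eq1// -normrX expr2 D normr1.
Qed.

Lemma det_row'_mutated n (v y : 'I_n.+1 -> 'rV[int]_n) (w : 'cV[int]_n) (k : nat)
    (a b : rat) :
  (k <= n)%N -> 0 < a -> 0 < b ->
  height w (toQ (v ord0)) = a -> height w (toQ (y ord0)) = - b ->
  (forall i : 'I_n, height w (toQ (v (lift ord0 i))) = if (i < k)%N then - b else 0) ->
  (forall i : 'I_n, toQ (y (lift ord0 i)) =
     if (i < k)%N then toQ (v ord0) + (a / b) *: (toQ (v (lift ord0 i)) - toQ (y ord0))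
     else toQ (v (lift ord0 i))) ->
  `|\det (row' ord0 (vmxQ y))| = (a / b) ^+ k * `|\det (row' ord0 (vmxQ v))|.
Proof.
move=> kn a0 b0 hv0 hy0 hv yE.
(* The reflection [x - (w(x) / a) z] negates [z], as [w(z) = 2 a]. It fixes height 0 and adds
   [(b / a) z] to a vertex of height [- b]; scaling by [a / b] then gives the vertex of Q. *)
pose z := toQ (v ord0) - (a / b) *: toQ (y ord0).
pose c := a^-1 *: map_mx intr w : 'cV[rat]_n.
pose D := \row_(i < n) (if (i < k)%N then a / b else 1).
have hc x : (x *m c) 0 0 = a^-1 * height w x by rewrite -scalemxAr mxE.
have zc : (z *m c) 0 0 = 2.
  rewrite hc /z -scaleNr heightD heightZ hv0 hy0.
  by field; rewrite ?gt_eqF.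
have -> : row' ord0 (vmxQ y) = diag_mx D *m row' ord0 (vmxQ v) *m (1%:M - c *m z).
  apply/row_matrixP => i.
  have rE (x : 'I_n.+1 -> 'rV[int]_n) : row i (row' ord0 (vmxQ x)) = toQ (x (lift ord0 i)).
    by rewrite -row_vmxQ; apply/rowP => j; rewrite !mxE.
  rewrite rE yE -mulmxA row_mul row_diag_mx -scalemxAl -rowE row_mul rE mxE.
  rewrite mulmxBr mulmx1 mulmxA [_ *m c]mx11_scalar hc hv mul_scalar_mx.
  case: ifP => _; last by rewrite mulr0 scale0r subr0 scale1r.
  rewrite /z !scalerBr !scalerA.
  have -> : a / b * (a^-1 * - b) = -1 by field; rewrite ?gt_eqF.
  rewrite mulN1r scaleN1r scaleNr !opprK opprD opprK addrA.
  by rewrite -addrA addrCA.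
rewrite !det_mulmx det_diag !normrM det_reflection// mulr1; congr (_ * _).
have -> : \prod_i D 0 i = (a / b) ^+ k.
  under eq_bigr do rewrite mxE.
  by rewrite -big_mkcond -(big_ord_widen n (fun=> a / b) kn) prodr_const card_ord.
by rewrite ger0_norm// exprn_ge0// divr_ge0// ltW.
Qed.

(** * The weights of the mutated simplex *)

(* The mutated weights with the first two exchanged: index 0 is then the weight of
   the vertex g of Q, listed in the same position as v_0 in P. *)
Definition swapped_weight (n : nat) (l : 'I_n.+1 -> nat) (k : nat) (i : 'I_n.+1) : nat :=
  let S := weight_sum l k in
  (if i == 0 :> nat then S ^ 2 else if i <= k then l ord0 * l i else l i * S)%N.

Lemma mutated_weight_tperm n (l : 'I_n.+1 -> nat) k i : (1 <= k <= n)%N ->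
  mutated_weight l k i = swapped_weight l k (tperm ord0 (inord 1) i).
Proof.
move=> /andP[k1 kn]; have n1 : (1 < n.+1)%N by rewrite ltnS (leq_trans k1).
have i1 : (inord 1 : 'I_n.+1) = 1%N :> nat by rewrite inordK.
rewrite /mutated_weight /swapped_weight; case: tpermP => [->|->|/eqP i0 /eqP ii1].
- by rewrite eqxx i1 /= k1.
- by rewrite i1.
- have /negPf -> : i != 0%N :> nat by apply: contra i0 => /eqP E; apply/eqP/val_inj.
  have /negPf -> // : i != 1%N :> nat.
  by apply: contra ii1 => /eqP E; apply/eqP/val_inj; rewrite /= i1.
Qed.

Lemma swapped_weight_relation n (v y : 'I_n.+1 -> 'rV[int]_n) l k (r : rat) :
  weights v l -> r * (l ord0)%:R = (weight_sum l k)%:R ->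
  (forall i : 'I_n.+1, i != ord0 -> toQ (y i) =
     if (i <= k)%N then toQ (v ord0) + r *: (toQ (v i) - toQ (y ord0))
     else toQ (v i)) ->
  \sum_i (swapped_weight l k i)%:R *: toQ (y i) = 0.
Proof.
move=> lP rE yE; have lS := weights_sumQ lP.
set S := weight_sum l k in rE *.
(* Term by term, the relation on Q is [S] times that on P plus [c i] times one fixed vector, and the
   [c i] sum to 0. *)
pose c (i : 'I_n.+1) : rat :=
  if i == ord0 then - S%:R else if (i <= k)%N then (l i)%:R else 0.
have c0 : \sum_i c i = 0.
  rewrite (bigD1 ord0)//= /c eqxx.
  rewrite (eq_bigr (fun i : 'I_n.+1 => if (i <= k)%N then (l i)%:R else 0)); last first.
    by move=> i /negPf ->.
  rewrite -big_mkcondr /= /S /weight_sum natr_sum addrC.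
  apply/eqP; rewrite subr_eq0; apply/eqP/eq_bigl => i.
  by rewrite lt0n.
have -> : \sum_i (swapped_weight l k i)%:R *: toQ (y i) =
    S%:R *: (\sum_i (l i)%:R *: toQ (v i)) +
    (\sum_i c i) *: ((l ord0)%:R *: toQ (v ord0) - S%:R *: toQ (y ord0)).
  rewrite scaler_sumr scaler_suml -big_split; apply: eq_bigr => i _ /=.
  rewrite /swapped_weight -/S /c -[i == 0 :> nat]/(i == ord0).
  have [->|i0] := eqVneq i ord0.
    rewrite scalerBr !scaleNr !scalerA opprK mulrC addrA subrr add0r.
    by rewrite natrX expr2.
  rewrite yE//; case: ifP => _.
    rewrite -rE natrM; apply/rowP => j; rewrite !mxE; ring.
  by rewrite scale0r addr0 scalerA natrM mulrC.
by rewrite lS c0 scaler0 scale0r addr0.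
Qed.

(** * Comparison of weights and multiplicities *)

Theorem theorem4p6 (n : nat)
    (v u : 'I_n.+1 -> 'rV[int]_n) (lam mu : 'I_n.+1 -> nat)
    (w : 'cV[int]_n) (F : set 'rV[rat]_n)
    (hP : fano_simplex v) (hQ : fano_simplex u)
    (hlam : weights v lam) (hmu : weights u mu)
    (hF : ~ is_point F)
    (hmut : is_mutation w (simplex v) F (simplex u)) :
  exists (s : 'S_n.+1) (k : nat),
    let v' := fun i => v (s i) in
    let lam' := fun i => lam (s i) in
    [/\ (1 <= k <= n)%N,
        slice w (hmax w (simplex v)) (simplex v) = [set toQ (v' ord0)],
        slice w (hmin w (simplex v)) (simplex v) =
          conv [set toQ (v' i) | i in [set i : 'I_n.+1 | (1 <= i <= k)%N]]
      & exists (t : 'S_n.+1) (d : nat),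
        [/\ (0 < d)%N,
            forall i, (mu (t i))%:R =
              d%:R^-1 * (mutated_weight lam' k i)%:R :> rat
          & d%:R * ((mult v)%:R / (mult u)%:R) =
              (lam' ord0)%:R ^ (k%:Z - 1) /
              (weight_sum lam' k)%:R ^ (k%:Z - 2) :> rat]].
Proof.
have [[_ vdim _ _] _ vertv] := hP; have [[_ udim _ _] _ _] := hQ.
have [I [t [p [a [b [[a0 b0 tI I0] hv hg uE]]]]]] :=
  mutation_vertices vdim vertv hlam hF hmut.
have [s [s0 sI]] := enumerating_perm tI.
pose k := #|I|; exists s, k => v' lam'.
have k1 : (0 < k)%N by rewrite lt0n cards_eq0.
have kn : (k <= n)%N.
  by have := max_card (t |: I)%SET; rewrite cardsU1 tI card_ord.
(* The vertices of Q in the order of those of P, the one of height [- b] coming first. *)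
pose y i := u (p (s i)).
have hv' i : height w (toQ (v' i)) =
    if i == ord0 then a else if (i <= k)%N then - b else 0.
  rewrite /v' hv -s0 (inj_eq (@perm_inj _ s)); case: (eqVneq i ord0) => // i0.
  by rewrite sI lt0n -[i == 0 :> nat]/(i == ord0) i0.
have yE i : i != ord0 -> toQ (y i) =
    if (i <= k)%N then toQ (v' ord0) + (a / b) *: (toQ (v' i) - toQ (y ord0))
    else toQ (v' i).
  move=> i0; rewrite /y /v' uE; last by rewrite -s0 (inj_eq (@perm_inj _ s)).
  by rewrite sI s0 lt0n -[i == 0 :> nat]/(i == ord0) i0.
have hy0 : height w (toQ (y ord0)) = - b by rewrite /y s0.
have Nb0 : - b < 0 by rewrite oppr_lt0.
have [N [kk bN]] := barycentric_ex vdim.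
have lam'P : weights v' lam' by apply: weights_perm.
pose S := weight_sum lam' k.
have lam0 : (0 < lam' ord0)%N by case: lam'P.
have aS : a * (lam' ord0)%:R = b * S%:R.
  have := weights_sum_height w lam'P; rewrite (bigD1 ord0)//= hv' eqxx.
  have -> : \sum_(i < n.+1 | i != ord0) (lam' i)%:R * height w (toQ (v' i)) = - (b * S%:R).
    rewrite /S /weight_sum natr_sum mulr_sumr -sumrN.
    under [RHS]eq_bigl do rewrite lt0n.
    rewrite [RHS]big_mkcondr; apply: eq_bigr => i i0; rewrite hv' (negPf i0).
    by case: ifP => _; rewrite ?mulr0// mulrN mulrC.
  by move/eqP; rewrite subr_eq0 mulrC => /eqP.
have S0 : (0 < S)%N.
  rewrite lt0n -(pnatr_eq0 rat) -(mulrI_eq0 _ (mulfI (lt0r_neq0 b0))) -aS.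
  by rewrite mulf_neq0 ?gt_eqF ?ltr0n.
have rE : a / b * (lam' ord0)%:R = S%:R.
  by rewrite mulrAC aS mulrAC divff ?mul1r ?gt_eqF.
have y_weights : weights y (fun i => mu (p (s i))) by exact: (weights_perm s (weights_perm p hmu)).
have ydim : full_dim (simplex y).
  by rewrite /y (simplex_perm (fun i => u (p i)) s) (simplex_perm u p).
have W0 i : (0 < swapped_weight lam' k i)%N.
  have [l0 _ _] := lam'P; rewrite /swapped_weight -/S; case: ifP => _.
    by rewrite expn_gt0 S0.
  by case: ifP => _; rewrite muln_gt0 ?l0.
have [d d0 Wd] := weights_proportional ydim y_weights W0
  (swapped_weight_relation lam'P rE yE).
split.
- by rewrite k1 kn.
- have -> : hmax w (simplex v) = a.
    rewrite (hmax_simplex (i := t)) ?hv ?eqxx// => j; rewrite !hv.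
    by do 2!case: ifP => _ //; rewrite ltW// (lt_trans Nb0).
  rewrite (slice_face (e := -1) bN)//; last first.
    move=> j; rewrite mulN1r opprB subr_ge0 hv.
    by do 2!case: ifP => _ //; rewrite ltW// (lt_trans Nb0).
  rewrite -[RHS]conv_set1; congr conv; apply/seteqP; split=> [_ [j hj <-]|_ ->].
    move: hj; rewrite /= hv /v' s0; case: eqVneq => [->//|_].
    by case: ifP => _ E; move: a0 Nb0; rewrite -E ?ltxx// => /lt_trans /[apply]; rewrite ltxx.
  by exists t; rewrite /= ?hv ?eqxx// /v' s0.
- have [i0 i0I] := finset.set0Pn _ I0.
  have i0t : i0 == t = false by apply: contraNF tI => /eqP <-.
  have low j : - b <= height w (toQ (v j)).
    rewrite hv; case: ifP => _; first by rewrite ltW// (lt_trans Nb0).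
    by case: ifP => _ //; apply: ltW.
  have -> : hmin w (simplex v) = - b.
    have hi0 : height w (toQ (v i0)) = - b by rewrite hv i0t i0I.
    by rewrite (hmin_simplex (i := i0)) hi0.
  rewrite (slice_face (e := 1) bN)//; last by move=> j; rewrite mul1r subr_ge0.
  congr conv; apply/seteqP; split=> [_ [j hj <-]|_ [j /= jk <-]].
    exists ((s^-1)%g j); rewrite /= /v' ?permKV// -sI permKV.
    move: hj; rewrite /= hv; case: ifP => _; last case: ifP => // _.
      by move=> E; move: a0; rewrite E => /lt_trans/(_ Nb0); rewrite ltxx.
    by move=> E; move: Nb0; rewrite -E ltxx.
  exists (s j) => //=; rewrite hv -s0 (inj_eq (@perm_inj _ s)) sI jk.
  by case: eqVneq jk => // ->.
exists (tperm ord0 (inord 1) * s * p)%g, d; split=> //.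
  move=> i; rewrite mutated_weight_tperm ?k1// Wd natrM mulKf; last by rewrite pnatr_eq0 -lt0n.
  by rewrite !permM.
have [Nv [kv bv]] : exists N k, barycentric v' N k by apply: barycentric_ex; rewrite simplex_perm.
have [Ny [ky bY]] := barycentric_ex ydim.
have [mX0 detX] := det_row'_mult (fun z => vmx_free bv) lam'P.
have [mY0 detY] := det_row'_mult (fun z => vmx_free bY) y_weights.
have detQ (x : 'I_n.+1 -> 'rV[int]_n) :
    `|\det (row' ord0 (vmxQ x))| = (`|\det (row' ord0 (vmx x))|%N)%:R.
  by rewrite /vmxQ -map_row' det_map_mx -intr_norm [RHS]pmulrn abszE.
(* Once the minors are read as multiplicity times weight, index 0 alone links the two
   multiplicities, since [d] times the weight of [y ord0] is [S ^ 2]. *)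
have E : `|\det (row' ord0 (vmxQ y))| = (a / b) ^+ k * `|\det (row' ord0 (vmxQ v'))|.
  apply: (det_row'_mutated (w := w)) => // i.
    by rewrite hv' lift0.
  by rewrite yE// lift0.
rewrite !detQ detX detY in E.
rewrite -(mult_perm v s) -(mult_perm u p) -(mult_perm (fun i => u (p i)) s) -/v' -/y -/S.
have Wd0 := Wd ord0; rewrite /swapped_weight /= -/S in Wd0.
have SQ : S%:R != 0 :> rat by rewrite pnatr_eq0 -lt0n.
have lQ : (lam' ord0)%:R != 0 :> rat by rewrite pnatr_eq0 -lt0n.
have mYQ : (mult y)%:R != 0 :> rat by rewrite pnatr_eq0 -lt0n.
have {}rE : a / b = S%:R / (lam' ord0)%:R by rewrite -rE mulfK.
have dQ : d%:R != 0 :> rat by rewrite pnatr_eq0 -lt0n.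
have muQ : (mu (p (s ord0)))%:R = S%:R ^+ 2 / d%:R :> rat.
  by rewrite -natrX Wd0 natrM mulrC mulKf.
have mXQ : (mult v')%:R = (mult y)%:R * (S%:R ^+ 2 / d%:R) *
    ((lam' ord0)%:R ^+ k / S%:R ^+ k) / (lam' ord0)%:R :> rat.
  move: E; rewrite !natrM muQ rE expr_div_n => ->.
  by field; rewrite lQ !expf_neq0.
(* The exponents are integers, [k - 2] being negative for [k = 1]; both powers are rewritten as
   quotients of natural powers. *)
have -> : (lam' ord0)%:R ^ (k%:Z - 1) = (lam' ord0)%:R ^+ k / (lam' ord0)%:R :> rat.
  by rewrite expfzDr.
have -> : S%:R ^ (k%:Z - 2) = S%:R ^+ k / S%:R ^+ 2 :> rat.
  by rewrite expfzDr.
rewrite mXQ; field.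
by rewrite dQ mYQ SQ lQ !expf_neq0.
Qed.
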